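(* Let $p\ge2$, $X=\{0,1,\dots,p\}$, and for $v\in X^\infty$ let $\Gamma^p_v$ be the infinite Schreier graph of $\mathcal G_{S_p}$ containing $v$. Then every $\Gamma^p_v$ is either $2p$-ended, or $2$-ended, or $1$-ended. More precisely, writing $E_k=\{w\in X^\infty:\Gamma^p_w\text{ is }k\text{-ended}\}$: (1) $E_{2p}=Cof(0^\infty)\cup Cof(1^\infty)\cup\cdots\cup Cof(p^\infty)$, and it consists of one orbit; (2) $E_2=\Bigl(\bigcup_{i=1}^p\bigcup_{w\in\{0,i\}^\infty}Cof(w)\Bigr)\setminus E_{2p}$, and it consists of uncountably many orbits; (3) $E_1=X^\infty\setminus(E_{2p}\cup E_2)$, and it consists of uncountably many orbits. Moreover $\nu(E_1)=1$.
   Context: $\mathcal G_{S_p}$ is the group generated by the transformations $e_1,\dots,e_p$ of $X^\ast\cup X^\infty$ defined recursively by $e_i(0w)=i\,e_i(w)$, $e_i(iw)=0w$, $e_i(jw)=jw$ for $j\notin\{0,i\}$. $\Gamma^p_v$ has vertex set the $\mathcal G_{S_p}$-orbit of $v$, with an edge joining $u$ and $e_i(u)$ for each vertex $u$ and each $i$. A graph is $k$-ended if it has exactly $k$ ends (the supremum over finite subgraphs $F$ of the number of infinite connected components of the graph minus $F$ equals $k$). $Cof(\xi)$ is the set of infinite words differing from $\xi$ in only finitely many positions. $\nu$ is the uniform (Bernoulli product) measure on $X^\infty$. *)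

(* Defs.v *)
From mathcomp Require Import all_boot all_order all_algebra.
From Stdlib Require Import Relations.
From Stdlib Require List.
Set Implicit Arguments. Unset Strict Implicit. Unset Printing Implicit Defensive.
Import Order.TTheory GRing.Theory Num.Theory.

Definition word (p : nat) := nat -> 'I_p.+1.

(* The generator e_i (defined recursively by e_i(0w)=i e_i(w), e_i(iw)=0w,
   e_i(jw)=jw), written out letterwise: the maximal initial block of 0's is
   replaced by i's, and the first nonzero letter is swapped i <-> 0
   (left unchanged if it is some j not in {0,i}); the rest is unchanged. *)
Definition gen (p : nat) (i : 'I_p.+1) (w : word p) : word p :=
  fun n => if [forall m : 'I_n, w m == ord0]
           then (if w n == ord0 then i else if w n == i then ord0 else w n)
           else w n.

Definition adj (p : nat) (u w : word p) : Prop :=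
  exists i : 'I_p.+1, (0 < i)%N /\ (w = gen i u \/ u = gen i w).

(* The G_{S_p}-orbit of v (= connected component of v in the graph above,
   since G_{S_p} is generated by the e_i). *)
Definition sorbit (p : nat) (v w : word p) : Prop :=
  @clos_refl_trans (word p) (@adj p) v w.

Definition conn_avoid (p : nat) (F : seq (word p)) (u w : word p) : Prop :=
  ~ Stdlib.Lists.List.In u F /\
  @clos_refl_trans (word p)
    (fun a b => adj a b /\ ~ Stdlib.Lists.List.In a F /\ ~ Stdlib.Lists.List.In b F) u w.

Definition infinite_set (T : Type) (S : T -> Prop) : Prop :=
  forall l : seq T, exists x, S x /\ ~ Stdlib.Lists.List.In x l.

Definition at_least_inf_comps (p : nat) (v : word p) (F : seq (word p)) (k : nat)
  : Prop :=
  exists f : 'I_k -> word p,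
    (forall a, sorbit v (f a) /\ ~ Stdlib.Lists.List.In (f a) F /\
               infinite_set (conn_avoid F (f a))) /\
    (forall a b, a <> b -> ~ conn_avoid F (f a) (f b)).

Definition k_ended (p : nat) (v : word p) (k : nat) : Prop :=
  (exists F, at_least_inf_comps v F k) /\
  (forall F, ~ at_least_inf_comps v F k.+1).

Definition cof (p : nat) (xi w : word p) : Prop :=
  exists N, forall n, (N <= n)%N -> w n = xi n.

Definition uncountably_many_orbits (p : nat) (E : word p -> Prop) : Prop :=
  ~ exists f : nat -> word p, forall w, E w -> exists n, sorbit (f n) w.

Definition in_cyl (p : nat) (u : seq 'I_p.+1) (w : word p) : Prop :=
  forall j : 'I_(size u), w j = nth ord0 u j.

(* nu-null set (nu = uniform Bernoulli product measure, nu([u]) = (p+1)^-|u|):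
   covered by countably many cylinders of arbitrarily small total measure. *)
Definition nu_null (p : nat) (N : word p -> Prop) : Prop :=
  forall eps : rat, (0 < eps)%R ->
  exists u : nat -> seq 'I_p.+1,
    (forall w, N w -> exists k, in_cyl (u k) w) /\
    (forall n, \sum_(k < n) ((p.+1)%:R ^- size (u k)) <= eps)%R.

(* Main.v *)
(* Each generator acts as a binary odometer on the maximal {0, i}-prefix of a
   word, so the e_i-orbits are cycles, except for the lines formed by the
   {0, i}-words, and the graph is a tree of cycles and lines.
   Upper bounds: if v_n <> 0, the finite block of words agreeing with v from
   position n on is left only through two vertices, both on the same e_(v_n)-orbit;
   hence at most two ends, and only one if that orbit is a finite cycle. For
   0^oo, the words constant from N on are left through 2p vertices.
   Lower bounds: removing a {0, i}-word o separates the two halves of its line,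
   because every other vertex of the orbit hangs on a single vertex of that line. *)
Require Import Defs.
From mathcomp Require Import all_boot all_order all_algebra.
From mathcomp Require Import zify ring.
From Stdlib Require Import Classical FunctionalExtensionality Relations.
From Stdlib Require List FinFun.
Import Order.TTheory GRing.Theory Num.Theory.
Set Implicit Arguments.
Unset Strict Implicit.
Unset Printing Implicit Defensive.

(** * Odometers on two letters *)

Definition swap (T : eqType) (a c x : T) : T :=
  if x == a then c else if x == c then a else x.

Lemma swapK (T : eqType) (a c : T) : cancel (swap a c) (swap c a).
Proof.
move=> x; rewrite /swap; case: (eqVneq x a) => [->|xa]; first by rewrite eqxx.
case: (eqVneq x c) => [->|xc]; last by rewrite (negPf xc) (negPf xa).
by case: eqVneq => [->|_]; rewrite ?eqxx.
Qed.

Lemma swap_eq (T : eqType) (a c x : T) : (swap a c x == c) = (x == a).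
Proof.
rewrite /swap; case: (eqVneq x a) => [_|xa]; first exact: eqxx.
by case: (eqVneq x c) => [<-|/negPf //]; rewrite eq_sym (negPf xa).
Qed.

Lemma swap_l (T : eqType) (a c : T) : swap a c a = c.
Proof. by rewrite /swap eqxx. Qed.

Lemma swap_r (T : eqType) (a c : T) : swap a c c = a.
Proof. by rewrite /swap eqxx; case: eqP. Qed.

Lemma swap_id (T : eqType) (a c x : T) : x != a -> x != c -> swap a c x = x.
Proof. by rewrite /swap => /negPf -> /negPf ->. Qed.

Section Odometer.
Variable p : nat.
Implicit Types (a c i j : 'I_p.+1) (u v w x y z q o : word p).

Definition starts a w n := [forall m : 'I_n, w m == a].

Lemma startsP a w n :
  reflect (forall m, m < n -> w m = a) (starts a w n).
Proof.
apply: (iffP forallP) => [H m mn|H m]; last by apply/eqP/H.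
by apply/eqP; exact: (H (Ordinal mn)).
Qed.

Lemma startsS a w n : starts a w n.+1 = starts a w n && (w n == a).
Proof.
apply/startsP/andP => [H|[/startsP H /eqP wn] m].
  by split; [apply/startsP => m mn; apply: H; lia | apply/eqP/H].
by rewrite ltnS leq_eqVlt => /predU1P[->//|]; exact: H.
Qed.

(* [odo a c] is the generator when a = 0, and its inverse when c = 0: both are
   carry operations on the maximal {a, c}-prefix. *)
Definition odo a c w : word p :=
  fun n => if starts a w n then swap a c (w n) else w n.

Lemma gen_odo i w : gen i w = odo ord0 i w.
Proof. by []. Qed.

Lemma odo_in a c w n : (forall m, m < n -> w m = a) -> odo a c w n = swap a c (w n).
Proof. by rewrite /odo => /startsP ->. Qed.

Lemma odo_out a c w m n : m < n -> w m != a -> odo a c w n = w n.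
Proof.
by rewrite /odo => mn wm; case: startsP => // /(_ _ mn) E; rewrite E eqxx in wm.
Qed.

Lemma odo_ge a c w m n :
  m <= n -> w m != a -> w m != c -> odo a c w n = w n.
Proof.
rewrite leq_eqVlt => /predU1P[<- wa wc|mn wa _]; last exact: odo_out wa.
by rewrite /odo swap_id //; case: ifP.
Qed.

Lemma starts_odo a c w n : starts c (odo a c w) n = starts a w n.
Proof.
elim: n => [|n IH]; first by apply/startsP/startsP.
rewrite !startsS IH /odo; case: (starts a w n) => //=.
exact: swap_eq.
Qed.

Lemma odoK a c : cancel (odo a c) (odo c a).
Proof.
move=> w; apply: functional_extensionality => n.
by rewrite {1}/odo starts_odo /odo; case: (starts a w n) => //; exact: swapK.
Qed.

Lemma iter_odoK a c n : cancel (iter n (odo a c)) (iter n (odo c a)).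
Proof. by elim: n => [//|n IH] w; rewrite iterSr iterS odoK IH. Qed.

Lemma first_diff a w n : ~~ starts a w n ->
  exists2 m, m < n & (forall l, l < m -> w l = a) /\ w m != a.
Proof.
elim: n => [/startsP[]//|n IH]; rewrite startsS negb_and.
case: (boolP (starts a w n)) => [/startsP H /= wn|/IH[m mn H] _]; first by exists n.
by exists m => //; lia.
Qed.

Definition pair_word a c w := forall n, w n = a \/ w n = c.

Lemma pair_wordC a c w : pair_word a c w -> pair_word c a w.
Proof. by move=> H n; case: (H n); [right|left]. Qed.

Lemma odo_pair a c w : pair_word a c w -> pair_word a c (odo a c w).
Proof.
move=> H n; rewrite /odo; case: ifP => _; last exact: H.
by rewrite /swap; do 2?case: ifP => _; auto.
Qed.

Lemma iter_odo_pair a c n w : pair_word a c w -> pair_word a c (iter n (odo a c) w).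
Proof. by move=> H; elim: n => //= n IH; exact: odo_pair. Qed.

(** Binary value of a prefix, least significant digit first, with [c] read as the digit 1. *)
Definition val2 c w n := \sum_(m < n) (w m == c) * 2 ^ m.

(** With [a] as 0 and [c] as 1, the carry is a decrement with borrow; the last term is the
    wrap-around when all [n] digits are 0. *)
Lemma val2_odo a c w n : a != c -> pair_word a c w ->
  val2 c (odo a c w) n + 1 = val2 c w n + starts a w n * 2 ^ n.
Proof.
move=> ac H; rewrite /val2; elim: n => [|n IH].
  by rewrite !big_ord0 (_ : starts a w 0) //; apply/startsP.
rewrite !big_ord_recr /= addnAC IH startsS /odo expnS.
case: (starts a w n) => /=; last lia.
rewrite swap_eq; case: (H n) => ->; rewrite eqxx ?(negPf ac) 1?eq_sym ?(negPf ac); lia.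
Qed.

(** Each step subtracts one modulo every power of 2. A return after [n.+1] steps would make [n.+1]
    vanish modulo [2 ^ n.+1], which is larger. *)
Lemma odo_free a c w n : a != c -> pair_word a c w -> iter n.+1 (odo a c) w <> w.
Proof.
move=> ac H E.
have mod_val k l : val2 c (iter k (odo a c) w) l + k = val2 c w l %[mod 2 ^ l].
  elim: k => [|k IH]; first by rewrite addn0.
  rewrite iterS -add1n addnA val2_odo //; last exact: iter_odo_pair.
  by rewrite addnAC addnC modnMDl.
have := mod_val n.+1 n.+1; rewrite E -[X in _ = X %[mod _]]addn0 => /eqP.
rewrite eqn_modDl mod0n modn_small //; exact: ltn_expl.
Qed.

(** The letter at [M] stops every carry, so all iterates share the tail from [M] on. Only finitely
    many prefixes remain; two iterates coincide by pigeonhole and injectivity cancels the smaller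
    exponent. *)
Lemma odo_periodic a c w M : w M != a -> w M != c ->
  exists n, iter n.+1 (odo a c) w = w.
Proof.
move=> wa wc.
have tail n l : M <= l -> iter n (odo a c) w l = w l.
  move=> Ml; elim: n l Ml => //= n IH l Ml.
  by rewrite (@odo_ge _ _ _ M) ?IH.
pose F n := [ffun m : 'I_M => iter n (odo a c) w m].
pose T := {ffun 'I_M -> 'I_p.+1}.
have /injectivePn[s [t st Est]] : ~~ injectiveb (fun s : 'I_(#|{: T}|.+1) => F s).
  by apply/injectiveP => /leq_card; rewrite card_ord => H; have := leq_trans H (leqnn #|{: T}|); rewrite ltnn.
have E : iter s (odo a c) w = iter t (odo a c) w.
  apply: functional_extensionality => l; case: (leqP M l) => lM; first by rewrite !tail.
  by move/ffunP: Est => /(_ (Ordinal lM)); rewrite !ffunE.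
have key (s' t' : nat) : s' < t' -> iter s' (odo a c) w = iter t' (odo a c) w ->
    exists n, iter n.+1 (odo a c) w = w.
  move=> lt E'; exists (t' - s').-1; apply: (can_inj (iter_odoK a c s')).
  by rewrite -iterD E'; congr iter; lia.
have : nat_of_ord s != t by [].
by rewrite neq_ltn => /orP[lt|lt]; [exact: key lt E | exact: key lt (esym E)].
Qed.

End Odometer.

(** * Orbits and cofinality *)

Section Orbit.
Variable p : nat.
Implicit Types (a c i j : 'I_p.+1) (u v w x y z q o : word p).

Lemma adjP x y : adj x y <->
  exists2 i : 'I_p.+1, 0 < i & y = odo ord0 i x \/ y = odo i ord0 x.
Proof.
split=> [[i [i0 [->|->]]]|[i i0 [->|->]]]; exists i => //.
- by left.
- by right; rewrite gen_odo odoK.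
- by split=> //; left.
- by split=> //; right; rewrite gen_odo odoK.
Qed.

Lemma adjC x y : adj x y -> adj y x.
Proof. by case=> i [i0 H]; exists i; split=> //; case: H; [right|left]. Qed.

Lemma sorbit_refl x : sorbit x x.
Proof. exact: rt_refl. Qed.

Lemma sorbit_trans y x z : sorbit x y -> sorbit y z -> sorbit x z.
Proof. exact: rt_trans. Qed.

Lemma sorbit_sym x y : sorbit x y -> sorbit y x.
Proof.
elim=> {x y} [x y /adjC|x|x y z _ H1 _ H2]; [exact: rt_step|exact: rt_refl|].
exact: rt_trans H2 H1.
Qed.

Lemma sorbit_block n x y : (forall m, n <= m -> x m = y m) -> sorbit x y.
Proof.
elim: n x y => [|n IH] x y xy.
  by have -> : x = y by [apply: functional_extensionality => m; exact: xy]; exact: rt_refl.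
pose zero x : word p := fun m => if m == n then ord0 else x m.
have to_zero w : sorbit w (zero w).
  (* Clearing the letters below [n] lets one step of the generator indexed by [w n] carry up to
     position [n] and turn [w n] into 0 there. *)
  pose w1 : word p := fun m => if m < n then ord0 else w m.
  have ww1 : sorbit w w1 by apply: IH => m nm; rewrite /w1 ltnNge nm.
  case: (eqVneq (w n) ord0) => [w0|w0].
    by apply: IH => m _; rewrite /zero; case: eqP => [->|].
  apply: sorbit_trans ww1 _; apply: (@sorbit_trans (odo ord0 (w n) w1)).
    by apply/rt_step/adjP; exists (w n); [rewrite lt0n|left].
  have w1n : w1 n = w n by rewrite /w1 ltnn.
  apply: IH => m; rewrite /zero leq_eqVlt eq_sym; case: (eqVneq m n) => [->|_] /= nm.
    rewrite odo_in => [|l ln]; last by rewrite /w1 ln.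
    by rewrite w1n swap_r.
  by rewrite (@odo_out _ _ _ _ n) // ?w1n // /w1 ltnNge ltnW.
apply: sorbit_trans (to_zero x) _; apply: sorbit_trans (sorbit_sym (to_zero y)).
by apply: IH => m nm; rewrite /zero; case: eqVneq => // nm'; apply: xy; lia.
Qed.

Lemma cof_sorbit x y : cof x y -> sorbit x y.
Proof. by case=> n H; apply: (@sorbit_block n) => m /H. Qed.

Definition ev_const x := exists c, cof (fun=> c) x.

Lemma cof_sym x y : cof x y -> cof y x.
Proof. by case=> n H; exists n => m /H. Qed.

Lemma cof_trans y x z : cof x y -> cof y z -> cof x z.
Proof.
case=> n H [m G]; exists (maxn n m) => l; rewrite geq_max => /andP[/H <- /G]. exact.
Qed.

Lemma odo_const a c : odo a c (fun=> a) = (fun=> c) :> word p.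
Proof. by apply: functional_extensionality => n; rewrite odo_in // swap_l. Qed.

Lemma odo_cof a c x : ~ ev_const x -> cof x (odo a c x).
Proof.
move=> nc; have [m xm] : exists m, x m != a.
  apply: NNPP => H; apply: nc; exists a, 0 => m _.
  by apply/eqP; apply/negPn/negP => xm; apply: H; exists m.
by exists m.+1 => n mn; rewrite (odo_out _ mn).
Qed.

Lemma adj_cof x y : ~ ev_const x -> adj x y -> cof x y.
Proof. by move=> nc /adjP[i i0 [->|->]]; exact: odo_cof. Qed.

Lemma ev_const_cof x y : cof x y -> ev_const x -> ev_const y.
Proof. by move=> xy [c cx]; exists c; exact: cof_trans xy. Qed.

Lemma sorbit_cof x y : ~ ev_const x -> sorbit x y -> cof x y.
Proof.
move=> nc xy; elim/clos_refl_trans_ind_left: {y}xy => [|y z _ xy yz]; first by exists 0.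
apply: (cof_trans xy); apply: adj_cof yz => /(ev_const_cof (cof_sym xy)); exact: nc.
Qed.

Lemma sorbit_ev_const x y : ev_const x -> sorbit x y -> ev_const y.
Proof.
move=> xc xy; apply: NNPP => yc; apply: yc.
apply: NNPP => yc; have := sorbit_cof yc (sorbit_sym xy).
by move/cof_sym/ev_const_cof => /(_ xc).
Qed.

(** The generator [e_c] sends 0^oo to c^oo, which merges the cofinality classes of all constant
    words into one orbit. *)
Lemma ev_const_sorbit x : ev_const x <-> sorbit (fun=> ord0) x.
Proof.
split=> [[c /cof_sorbit]|]; last by apply: sorbit_ev_const; exists ord0, 0.
apply: sorbit_trans; case: (eqVneq c ord0) => [->|c0]; first exact: sorbit_refl.
by apply/rt_step/adjP; exists c; [rewrite lt0n|left; rewrite odo_const].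
Qed.

End Orbit.

(** * Ends and finite vertex sets *)

Section Ends.
Variable p : nat.
Implicit Types (a c i j : 'I_p.+1) (u v w x y z q o : word p).

Lemma conn_avoid_sym F x y : conn_avoid F x y -> conn_avoid F y x.
Proof.
case=> xF xy; split.
  by elim: xy xF => // {x y} [x y [_ []] //|x y z _ H1 _ H2 /H1 /H2].
elim: xy => {x y xF} [x y [/adjC]|x|x y z _ H1 _ H2]; last exact: rt_trans H2 H1.
  by move=> yx [xF yF]; apply: rt_step.
exact: rt_refl.
Qed.

Lemma conn_avoid_trans F y x z :
  conn_avoid F x y -> conn_avoid F y z -> conn_avoid F x z.
Proof. by move=> [xF xy] [_ yz]; split=> //; exact: rt_trans yz. Qed.

Lemma conn_avoid_sorbit F x y : conn_avoid F x y -> sorbit x y.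
Proof.
case=> _; elim=> {x y} [x y [H _]|x|x y z _ H1 _ H2]; last exact: rt_trans H2.
  exact: rt_step.
exact: rt_refl.
Qed.

Lemma conn_avoid_step F x y z : conn_avoid F x y -> adj y z ->
  ~ List.In z F -> conn_avoid F x z.
Proof.
move=> xy yz zF; have [yF _] := conn_avoid_sym xy.
by apply: (conn_avoid_trans xy); split=> //; apply: rt_step.
Qed.

Lemma sorbit_conn_nil x y : sorbit x y -> conn_avoid [::] x y.
Proof.
move=> xy; split=> //; elim: xy => {x y} [x y H|x|x y z _ H1 _ H2]; last exact: rt_trans H2.
  by apply: rt_step; do 2?split=> //.
exact: rt_refl.
Qed.

Lemma In_map (T : eqType) (U : Type) (f : T -> U) s t :
  t \in s -> List.In (f t) (map f s).
Proof.
by elim: s => //= t' s IH; rewrite inE => /predU1P[->|/IH]; [left|right].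
Qed.

Lemma finite_blocks N (C : finType) (w : C -> word p) :
  exists l : seq (word p), forall (c : C) x, (forall m, N <= m -> x m = w c m) -> List.In x l.
Proof.
pose f (gc : {ffun 'I_N -> 'I_p.+1} * C) : word p :=
  fun m => if insub m is Some t then gc.1 t else w gc.2 m.
exists (map f (enum {: {ffun 'I_N -> 'I_p.+1} * C})) => c x xw.
have -> : x = f ([ffun t : 'I_N => x t], c).
  apply: functional_extensionality => m; rewrite /f /=.
  by case: insubP => [t _ <-|]; rewrite ?ffunE // -leqNgt => /xw.
by apply: In_map; rewrite mem_enum.
Qed.

Lemma injective_infinite (T : Type) (S : T -> Prop) (s : nat -> T) :
  (forall m n, s m = s n -> m = n) -> (forall n, S (s n)) -> infinite_set S.
Proof.
move=> s_inj sS l; apply: NNPP => nx.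
have sl n : List.In (s n) l by apply: NNPP => H; apply: nx; exists (s n).
have ND : List.NoDup (List.map s (List.seq 0 (List.length l).+1)).
  by apply: FinFun.Injective_map_NoDup; [exact: s_inj|exact: List.seq_NoDup].
have := List.NoDup_incl_length ND.
rewrite List.length_map List.length_seq => H.
suff /H : List.incl (List.map s (List.seq 0 (List.length l).+1)) l by lia.
by move=> t /List.in_map_iff[n [<- _]].
Qed.

Lemma at_least_anti v F k l : l <= k -> at_least_inf_comps v F k -> at_least_inf_comps v F l.
Proof.
move=> lk [f [Hf sep]]; exists (fun t => f (widen_ord lk t)); split=> [t|s t st]; first exact: Hf.
by apply: sep => /(congr1 val) /= /val_inj.
Qed.

Lemma k_ended_uniq v k l : k_ended v k -> k_ended v l -> k = l.
Proof.
move=> [[F HF] nk] [[G HG] nl]; case: (ltngtP k l) => // lt.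
  by case: (nk G); apply: at_least_anti HG.
by case: (nl F); apply: at_least_anti HF.
Qed.

Lemma at_least_sorbit u v F k : sorbit u v ->
  at_least_inf_comps u F k -> at_least_inf_comps v F k.
Proof.
move=> uv [f [Hf sep]]; exists f; split=> // t; have [H1 H2] := Hf t.
by split=> //; apply: sorbit_trans H1; exact: sorbit_sym.
Qed.

Lemma k_ended_sorbit u v k : sorbit u v -> k_ended u k -> k_ended v k.
Proof.
move=> uv [[F HF] nk]; split; first by exists F; apply: at_least_sorbit HF.
by move=> G HG; apply: (nk G); apply: at_least_sorbit HG; exact: sorbit_sym.
Qed.

Definition outside (K : word p -> Prop) :=
  clos_refl_trans (word p) (fun x y => adj x y /\ ~ K x /\ ~ K y).

(** Following paths from [v], every orbit vertex outside [K] is joined to some [r t] while avoiding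
    [F], because all ways out of [K] lead there. An infinite component has a vertex outside the
    finite [K], so two of [k.+1] components share a representative. *)
Lemma ends_le v F (K : word p -> Prop) l k (r : 'I_k -> word p) :
  (forall x, K x -> List.In x l) -> K v ->
  (forall x, List.In x F -> sorbit v x -> K x) ->
  (forall x y, K x -> ~ K y -> adj x y -> exists t, outside K y (r t)) ->
  ~ at_least_inf_comps v F k.+1.
Proof.
move=> Kl Kv FK exits [f [Hf sep]].
have out x y : sorbit v x -> ~ K x -> outside K x y -> conn_avoid F x y.
  move=> vx Kx xy; elim/clos_refl_trans_ind_left: {y}xy => [|y z _ xy [yz [_ Kz]]].
    by split; [move=> /FK/(_ vx)|exact: rt_refl].
  apply: (conn_avoid_step xy yz) => /FK zF; apply/Kz/zF.
  by apply: sorbit_trans vx _; apply: sorbit_trans (conn_avoid_sorbit xy) _; exact: rt_step.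
have reach x : sorbit v x -> K x \/ exists t, conn_avoid F x (r t).
  move=> vx; elim/clos_refl_trans_ind_left: {x}vx => [|x y vx IH xy]; first by left.
  have vy : sorbit v y by apply: sorbit_trans vx _; exact: rt_step.
  case: (classic (K y)) => [|Ky]; [by left|right].
  case: IH => [Kx|[t xt]].
    by have [t yt] := exits _ _ Kx Ky xy; exists t; exact: out.
  exists t; apply: conn_avoid_sym; apply: conn_avoid_step (conn_avoid_sym xt) xy _.
  by move=> /FK/(_ vy).
have /fin_all_exists[g Hg] : forall s : 'I_k.+1, exists t, conn_avoid F (f s) (r t).
  move=> s; have [vs [_ /(_ l)[x [sx xl]]]] := Hf s.
  have [Kx|[t xt]] := reach x (sorbit_trans vs (conn_avoid_sorbit sx)).
    by case: xl; exact: Kl.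
  by exists t; apply: conn_avoid_trans sx xt.
have /injectivePn[s [t st E]] : ~~ injectiveb g.
  by apply/injectiveP => /leq_card; rewrite !card_ord ltnn.
apply: (sep s t); first exact/eqP.
by apply: conn_avoid_trans (Hg s) _; rewrite E; exact: conn_avoid_sym.
Qed.

Lemma eventually_In F (P : nat -> word p -> Prop) :
  (forall m n x, m <= n -> P m x -> P n x) ->
  exists N, forall x n, List.In x F -> P n x -> P N x.
Proof.
move=> Pmon; elim: F => [|y F [N HN]]; first by exists 0.
case: (classic (exists n, P n y)) => [[n Py]|nP].
  exists (maxn n N) => x m [<- _|xF /(HN _ _ xF) PN];
    [exact: (Pmon n _ _ (leq_maxl _ _) Py)|exact: (Pmon N _ _ (leq_maxr _ _) PN)].
by exists N => x m [<- Py|]; [case: nP; exists m|exact: HN].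
Qed.

End Ends.

(** * Upper bounds on the number of ends *)

Section UpperBounds.
Variable p : nat.
Implicit Types (a c i j : 'I_p.+1) (u v w x y z q o : word p).

Definition blk a n w : word p := fun m => if m < n then a else w m.

Definition agree n v x := forall m, n <= m -> x m = v m.

(** To alter a letter at [n] or later, the carry must run through the whole prefix, which is then
    constantly [a]; a letter at [n] other than [a] and [c] would stop it. *)
Lemma agree_exit a c v n x : agree n v x -> ~ agree n v (odo a c x) ->
  x = blk a n v /\ (v n = a \/ v n = c).
Proof.
move=> Kx Ky; have st : starts a x n.
  apply/negPn/negP => /first_diff[m mn [_ xm]]; apply: Ky => l nl.
  by rewrite (odo_out _ (leq_trans mn nl) xm) Kx.
split.
  apply: functional_extensionality => m; rewrite /blk; case: ltnP => [mn|/Kx //].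
  exact: (startsP _ _ _ st).
case: (eqVneq (v n) a) => [|va]; first by left.
case: (eqVneq (v n) c) => [|vc]; first by right.
by case: Ky => m nm; rewrite (@odo_ge _ _ _ _ n) ?Kx.
Qed.

Definition leaf_exit_fwd v n := odo ord0 (v n) (blk ord0 n v).
Definition leaf_exit_bwd v n := odo (v n) ord0 (blk (v n) n v).

(** As [v n] is nonzero, only the generator indexed by [v n] and its inverse can act at position
    [n], each from a single word of the block. *)
Lemma leaf_exits v n x y : v n != ord0 -> agree n v x -> ~ agree n v y ->
  adj x y -> y = leaf_exit_fwd v n \/ y = leaf_exit_bwd v n.
Proof.
move=> vn Kx Ky /adjP[i i0 [E|E]]; rewrite E in Ky *.
  have [-> [E0|<-]] := agree_exit Kx Ky; last by left.
  by rewrite E0 eqxx in vn.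
have [-> [<-|E0]] := agree_exit Kx Ky; first by right.
by rewrite E0 eqxx in vn.
Qed.

Lemma agree_finite n v : exists l, forall x, agree n v x -> List.In x l.
Proof.
have [l Hl] := finite_blocks n (fun _ : 'I_1 => v).
by exists l => x Hx; apply: (Hl ord0).
Qed.

Lemma leaf_level v F : ~ ev_const v ->
  exists n, v n != ord0 /\ forall x, List.In x F -> sorbit v x -> agree n v x.
Proof.
move=> nc; have [|N HN] := @eventually_In p F (fun n x => agree n v x).
  by move=> m n x mn H l nl; apply: H; apply: leq_trans nl.
have [n Nn vn] : exists2 n, N <= n & v n != ord0.
  apply: NNPP => H; apply: nc; exists ord0, N => n Nn.
  by apply/eqP/negPn/negP => vn; apply: H; exists n.
exists n; split=> // x xF /(sorbit_cof nc)[m Hm] l nl.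
by apply: (HN x m) => //; apply: leq_trans nl.
Qed.

Lemma ends_le2 v F : ~ ev_const v -> ~ at_least_inf_comps v F 3.
Proof.
move=> nc; have [n [vn Fn]] := leaf_level F nc; have [l Hl] := agree_finite n v.
pose r (t : 'I_2) := if t == ord0 then leaf_exit_fwd v n else leaf_exit_bwd v n.
apply: (@ends_le _ _ _ (agree n v) l 2 r) => // x y Kx Ky xy.
by have [->|->] := leaf_exits vn Kx Ky xy; [exists ord0|exists ord_max]; apply: rt_refl.
Qed.

(* The two exits of a leaf block lie on one finite cycle, whose part outside
   the block is an arc joining them. *)
Lemma leaf_exits_connected v n M : v n != ord0 -> n <= M ->
  v M != ord0 -> v M != v n -> ~ agree n v (leaf_exit_bwd v n) ->
  outside (agree n v) (leaf_exit_bwd v n) (leaf_exit_fwd v n).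
Proof.
move=> vn nM v0 vj Kz; set z := leaf_exit_bwd v n; set K := agree n v.
have zM : z M = v M.
  by rewrite /z /leaf_exit_bwd (@odo_ge _ _ _ _ M) // /blk ltnNge nM.
have [L perL] : exists L, iter L.+1 (odo (v n) ord0) z = z.
  by apply: (@odo_periodic _ _ _ _ M); rewrite zM.
have walk t : outside K z (leaf_exit_fwd v n) \/
    ~ K (iter t (odo (v n) ord0) z) /\ outside K z (iter t (odo (v n) ord0) z).
  elim: t => [|t [?|[Kw zw]]]; [by right; split=> //; apply: rt_refl|by left|].
  set w := iter t _ z in Kw zw; have ww : odo ord0 (v n) (odo (v n) ord0 w) = w by exact: odoK.
  case: (classic (K (odo (v n) ord0 w))) => Kw'.
    left; suff <- : w = leaf_exit_fwd v n by [].
    by rewrite -ww in Kw *; have [-> _] := agree_exit Kw' Kw.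
  right; split=> //; apply: rt_trans zw _; apply: rt_step; split=> //.
  by apply/adjP; exists (v n); [rewrite lt0n|right].
(* One step before the cycle closes, the iterate is the predecessor of [z], a word of the block. The
   walk has thus re-entered the block, which it can only do from [leaf_exit_fwd v n]. *)
have [//|[KL _]] := walk L; case: KL.
have <- : blk (v n) n v = iter L (odo (v n) ord0) z.
  by apply: (can_inj (@odoK p (v n) ord0)); rewrite -iterS perL.
by move=> m nm; rewrite /blk ltnNge nm.
Qed.

Lemma ends_le1 v F : ~ ev_const v ->
  (forall i u, 0 < i -> pair_word ord0 i u -> ~ cof u v) ->
  ~ at_least_inf_comps v F 2.
Proof.
move=> nc npair; have [n [vn Fn]] := leaf_level F nc; have [l Hl] := agree_finite n v.
apply: (@ends_le _ _ _ (agree n v) l 1 (fun=> leaf_exit_fwd v n)) => // x y Kx Ky xy.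
exists ord0; have [->|E] := leaf_exits vn Kx Ky xy; first exact: rt_refl.
(* Otherwise [v] uses only 0 and [v n] from [n] on, and zeroing its first [n] letters gives a {0,
   [v n]}-word cofinal with it. *)
have [M nM /andP[v0 vj]] : exists2 M, n <= M & (v M != ord0) && (v M != v n).
  apply: NNPP => H; apply: (npair (v n) (blk ord0 n v)); first by rewrite lt0n.
    move=> m; rewrite /blk; case: ltnP => [_|nm]; first by left.
    case: (eqVneq (v m) ord0) => v0; first by left.
    by right; apply/eqP/negPn/negP => vm; apply: H; exists m; rewrite ?v0.
  by exists n => m nm; rewrite /blk ltnNge nm.
by rewrite E in Ky *; exact: (leaf_exits_connected vn nM).
Qed.

Definition direction b i := if b then odo ord0 i else odo i ord0 : word p -> word p.

(** Numbering of the half-lines at 0^oo: one for each nonzero letter and each direction. *)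
Definition line_index (t : 'I_(2 * p)) : 'I_p.+1 * bool := (inord t./2.+1, odd t).

Lemma line_index_gt0 t : 0 < (line_index t).1.
Proof. by rewrite /= inordK //; have := ltn_ord t; lia. Qed.

Lemma line_index_inj : injective line_index.
Proof.
move=> s t [/(congr1 val)]; rewrite /= !inordK => [st odd_st||].
- by apply: val_inj; rewrite /= -(odd_double_half s) -(odd_double_half t); lia.
- by have := ltn_ord t; lia.
- by have := ltn_ord s; lia.
Qed.

Lemma line_index_surj i b : 0 < i -> exists t, line_index t = (i, b).
Proof.
move=> i0; have lt : b + i.-1.*2 < 2 * p by have := ltn_ord i; case: b; lia.
exists (Ordinal lt); rewrite /line_index /= half_bit_double prednK // inord_val.
by rewrite oddD odd_double addbF; case: b lt.
Qed.

Lemma ends_le_const F : ~ at_least_inf_comps (fun=> ord0 : 'I_p.+1) F (2 * p).+1.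
Proof.
have [|N HN] := @eventually_In p F (fun n x => exists c, agree n (fun=> c) x).
  by move=> m n x mn [c H]; exists c => l nl; apply: H; apply: leq_trans nl.
have [l Hl] := @finite_blocks p N 'I_p.+1 (fun c _ => c).
pose r i b := if b then odo ord0 i (blk ord0 N (fun=> i))
              else odo i ord0 (blk i N (fun=> ord0)).
apply: (@ends_le _ _ _ (fun x => exists c, agree N (fun=> c) x) l (2 * p)
          (fun t => let: (i, b) := line_index t in r i b)).
- by move=> x [c Hc]; apply: (Hl c).
- by exists ord0.
- by move=> x xF /ev_const_sorbit[c [n Hn]]; apply: (HN x n) => //; exists c.
(* The other case of [agree_exit], a tail of letters [a], makes [x] the word a^oo, whose image c^oo
   is still in the set. *)
have exit a c x : (exists d, agree N (fun=> d) x) ->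
    ~ (exists d, agree N (fun=> d) (odo a c x)) -> x = blk a N (fun=> c).
  move=> [d Kx] Ky; have [|xE [da|<- //]] := @agree_exit a c (fun=> d) N x Kx.
    by move=> H; apply: Ky; exists d.
  case: Ky; exists c; have -> : x = (fun=> a); last by rewrite odo_const.
  by rewrite xE; apply: functional_extensionality => m; rewrite /blk da if_same.
move=> x y Kx Ky /adjP[i i0 [E|E]]; rewrite E in Ky *; rewrite (exit _ _ _ Kx Ky).
  by have [t Ht] := line_index_surj true i0; exists t; rewrite Ht; exact: rt_refl.
by have [t Ht] := line_index_surj false i0; exists t; rewrite Ht; exact: rt_refl.
Qed.

End UpperBounds.

(** * Lower bounds on the number of ends *)

Section LowerBounds.
Variable p : nat.
Implicit Types (a c i j : 'I_p.+1) (u v w x y z q o : word p).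

Lemma ends_ge1 v : 0 < p -> at_least_inf_comps v [::] 1.
Proof.
move=> p0; exists (fun=> v); split=> [_|a b]; last by rewrite !ord1.
split; first exact: sorbit_refl.
split=> //; pose s n : word p := fun m => if m == n then
  (if v m == ord0 then ord_max else ord0) else v m.
apply: (@injective_infinite _ _ s) => [m n /(congr1 (fun f => f m))|n].
  rewrite /s eqxx; case: (eqVneq m n) => // _; case: eqP => [->|E /esym //].
  by move/(congr1 val) => /=; lia.
apply: sorbit_conn_nil; apply: cof_sorbit; exists n.+1 => m nm.
by rewrite /s; case: eqP => // E; rewrite E ltnn in nm.
Qed.

(* [q] lies on the e_i-line of {0, i}-words and is the vertex through which
   [x] hangs on that line. *)
Definition hangs i x q := x = q \/ exists m,
  [/\ forall n, m < n -> x n = q n, forall n, n <= m -> q n = ord0,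
      x m != ord0 & x m != i].

(** In the hanging case [m] is the last position of [x] with a letter outside {0, [i]}. The carry
    either keeps that letter or erases it, which moves the position down by one or gives back [q].
    The word 0^oo is excluded because [e_c] sends it to c^oo, which does not hang on it when [c]
    differs from [i]. *)
Lemma hangs_fwd i c x q : i != ord0 -> c != ord0 -> pair_word ord0 i q ->
  q <> (fun=> ord0) -> hangs i x q ->
  hangs i (odo ord0 c x) q \/ x = q /\ c = i.
Proof.
move=> i0 c0 Hq q0; case: (eqVneq c i) => ci [->|[m [xq qm xm0 xmi]]]; first by right.
- left; right; exists m; have keep n : m <= n -> odo ord0 c x n = x n.
    by move=> mn; rewrite (@odo_ge _ _ _ _ m) ?ci.
  by split=> // [n mn||]; rewrite keep // ?xq // ltnW.
- left; have [M Mq qM] : exists2 M, forall n, n < M -> q n = ord0 & q M = i.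
    have [n qn] : exists n, q n != ord0.
      apply: NNPP => H; apply: q0; apply: functional_extensionality => n.
      by apply/eqP/negPn/negP => qn; apply: H; exists n.
    have /first_diff[M _ [HM qM]] : ~~ starts ord0 q n.+1.
      by apply/negP => /startsP/(_ n (ltnSn n)) E; rewrite E eqxx in qn.
    by exists M => //; case: (Hq M) => // E; rewrite E eqxx in qM.
  have keep n : M <= n -> odo ord0 c q n = q n.
    by move=> Mn; rewrite (@odo_ge _ _ _ _ M) ?qM // eq_sym.
  case: M => [|m] in Mq qM keep *.
    by left; apply: functional_extensionality => n; exact: keep.
  right; exists m; have ym : odo ord0 c q m = c.
    by rewrite odo_in => [|n nm]; [rewrite Mq // swap_l|apply: Mq; lia].
  by rewrite ym; split.
left; case: (boolP (starts ord0 x m)) => [/startsP st|/first_diff[r rm [_ xr]]]; last first.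
  have keep n : m <= n -> odo ord0 c x n = x n.
    by move=> mn; rewrite (odo_out _ (leq_trans rm mn)).
  by right; exists m; split=> // [n mn||]; rewrite keep // ?xq // ltnW.
case: (eqVneq (x m) c) => xc; last first.
  have keep n : m <= n -> odo ord0 c x n = x n by move=> mn; rewrite (@odo_ge _ _ _ _ m).
  by right; exists m; split=> // [n mn||]; rewrite keep // ?xq // ltnW.
have above n : m <= n -> odo ord0 c x n = q n.
  rewrite leq_eqVlt => /predU1P[<-|mn]; last by rewrite (odo_out _ mn) // xq.
  by rewrite odo_in // xc qm // swap_r.
case: m => [|m] in xq qm xm0 xmi st xc above *.
  by left; apply: functional_extensionality => n; exact: above.
right; exists m; have ym : odo ord0 c x m = c.
  by rewrite odo_in => [|n nm]; [rewrite st // swap_l|apply: st; lia].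
by rewrite ym; split=> // n nm; apply: qm; lia.
Qed.

(** For [c] other than [i], the inverse carry runs over letters [c], which do not occur in [q], so
    it ends by position [m.+1]. If it gets that far, a 0 there becomes the new last foreign letter,
    while an [i] means that the word has become [q]. *)
Lemma hangs_bwd i c x q : i != ord0 -> c != ord0 -> pair_word ord0 i q ->
  hangs i x q -> hangs i (odo c ord0 x) q \/ x = q /\ c = i.
Proof.
move=> i0 c0 Hq; case: (eqVneq c i) => ci [->|[m [xq qm xm0 xmi]]]; first by right.
- left; right; exists m; have keep n : m <= n -> odo c ord0 x n = x n.
    by move=> mn; rewrite (@odo_ge _ _ _ _ m) ?ci.
  by split=> // [n mn||]; rewrite keep // ?xq // ltnW.
- left; case: (Hq 0) => q0.
    have y0 : odo c ord0 q 0 = c by rewrite odo_in // q0 swap_r.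
    right; exists 0; rewrite y0; split=> // [n n0|n]; last by rewrite leqn0 => /eqP ->.
    by rewrite (@odo_out _ _ _ _ 0) // q0 eq_sym.
  by left; apply: functional_extensionality => n; rewrite (@odo_ge _ _ _ _ 0) // q0 // eq_sym.
left; case: (boolP (starts c x m.+1)) => [/startsP st|/first_diff[r rm [_ xr]]]; last first.
  have keep n : m <= n -> odo c ord0 x n = x n.
    rewrite leq_eqVlt => /predU1P[<-|mn]; last first.
      by rewrite (odo_out _ (leq_ltn_trans _ mn) xr).
    move: rm; rewrite ltnS leq_eqVlt => /predU1P[E|rm]; last by rewrite (odo_out _ rm).
    by rewrite (@odo_ge _ _ _ _ m) // -E.
  by right; exists m; split=> // [n mn||]; rewrite keep // ?xq // ltnW.
case: (Hq m.+1) => qS; have xS := xq m.+1 (ltnSn m); rewrite qS in xS.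
  right; exists m.+1; have yS : odo c ord0 x m.+1 = c.
    by rewrite odo_in // xS swap_r.
  rewrite yS; split=> // n mn.
    by rewrite (odo_out _ mn) ?xS 1?eq_sym // xq // ltnW.
  by move: mn; rewrite leq_eqVlt => /predU1P[->|/qm].
left; apply: functional_extensionality => n; case: (leqP n m) => nm.
  rewrite odo_in => [|l ln]; last by apply: st; lia.
  by rewrite st // swap_l qm.
by rewrite (@odo_ge _ _ _ _ m.+1) ?xS ?xq // eq_sym.
Qed.

(** One branch at [o]: the open half-line in direction [b] with all that hangs on it. *)
Definition side i b o x := exists t, hangs i x (iter t.+1 (direction b i) o).

Lemma directionK b i : cancel (direction b i) (direction (~~ b) i).
Proof. by case: b; exact: odoK. Qed.

Lemma direction_pair b i n o : pair_word ord0 i o ->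
  pair_word ord0 i (iter n (direction b i) o).
Proof.
case: b => H; first exact: iter_odo_pair.
by apply/pair_wordC/iter_odo_pair/pair_wordC.
Qed.

Lemma direction_free b i n o : i != ord0 -> pair_word ord0 i o ->
  iter n.+1 (direction b i) o <> o.
Proof.
case: b => i0 H; apply: odo_free => //; first by rewrite eq_sym.
exact: pair_wordC.
Qed.

Lemma direction_adj b i x : 0 < i -> adj x (direction b i x).
Proof. by move=> i0; apply/adjP; exists i => //; case: b; [left|right]. Qed.

Section Line.
Variables (o : word p) (i : 'I_p.+1).
Hypotheses (i0 : 0 < i) (Ho : pair_word ord0 i o).
(** The lines of all letters meet at 0^oo, so this word may occur here only as [o] itself. *)
Hypothesis never0 : forall b n, iter n.+1 (direction b i) o <> (fun=> ord0).

Let i_neq0 : i != ord0. Proof. by rewrite -val_eqE -lt0n. Qed.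

(** A step either keeps the vertex on which the word hangs or moves along the line; the half-line
    can only be left through [o]. *)
Lemma side_adj b x y : adj x y -> y <> o -> side i b o x -> side i b o y.
Proof.
move=> /adjP[c c0 xy] yo [t Ht]; rewrite lt0n in c0.
set q := iter t.+1 _ o in Ht; have Hq : pair_word ord0 i q by exact: direction_pair.
suff [H|E] : hangs i y q \/ y = direction b i q \/ y = direction (~~ b) i q.
- by exists t.
- case: E => E; first by exists t.+1; left; rewrite E.
  move: E; rewrite /q /= directionK; case: t => [//|t] in q Hq Ht * => E.
  by exists t; left.
case: xy => ->.
  have [H|[-> ->]] := hangs_fwd i_neq0 c0 Hq (@never0 b t) Ht; first by left.
  by right; rewrite /direction; case: (b); [left|right].
have [H|[-> ->]] := hangs_bwd i_neq0 c0 Hq Ht; first by left.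
by right; rewrite /direction; case: (b); [right|left].
Qed.

Lemma side_conn b x y : conn_avoid [:: o] x y -> side i b o x -> side i b o y.
Proof.
case=> _; elim=> {x y} [x y [xy [_ yo]]|//|x y z _ H1 _ H2 /H1 //].
by apply: side_adj xy _ => E; apply: yo; left.
Qed.

Lemma side_infinite b : infinite_set (conn_avoid [:: o] (direction b i o)).
Proof.
have avoid t : ~ List.In (iter t.+1 (direction b i) o) [:: o].
  by case=> // /esym; exact: direction_free.
apply: (@injective_infinite _ _ (fun t => iter t.+1 (direction b i) o)).
  have lt_neq m n : m < n ->
      iter m.+1 (direction b i) o <> iter n.+1 (direction b i) o.
    move=> mn; have -> : n.+1 = (n - m).-1.+1 + m.+1 by lia.
    rewrite iterD => E; have := direction_free (b := b) (n := (n - m).-1) i_neq0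
      (direction_pair b m.+1 Ho); exact.
  by move=> m n E; case: (ltngtP m n) => // /lt_neq; rewrite E.
elim=> [|t IH]; first by split; [exact: (avoid 0)|exact: rt_refl].
by apply: (conn_avoid_step IH _ (avoid t.+1)); apply: direction_adj.
Qed.

Lemma side_self b : side i b o (direction b i o).
Proof. by exists 0; left. Qed.

Lemma side_opp b : ~ side i b o (direction (~~ b) i o).
Proof.
have Hx : pair_word ord0 i (direction (~~ b) i o) by exact: (direction_pair _ 1).
case=> t [E|[m [_ _]]]; last by case: (Hx m) => ->; rewrite eqxx.
apply: (@direction_free b i t.+1 o) => //.
by rewrite iterS -E -{1}[b]negbK directionK.
Qed.

(** The word is j^oo or j0^oo. The first has letters [j] beyond every position; the second could
    only hang on 0^oo, which the half-line avoids. *)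
Lemma side_other b (c : bool) j : 0 < j -> j != i -> o = (fun=> ord0) ->
  ~ side i b o (direction c j o).
Proof.
rewrite lt0n => j0 ji o0 [t]; set x := direction c j o; set q := iter _ _ _ => Hx.
have Hq : pair_word ord0 i q by exact: direction_pair.
have xj : x 0 = j.
  by rewrite /x o0; case: c {x Hx}; rewrite /= odo_in //= ?swap_l ?swap_r.
case: Hx => [E|[m [xq qm _ _]]].
  by case: (Hq 0); rewrite -E xj => /eqP; [rewrite -val_eqE (negPf j0)|apply/negP].
case: c => [|] in x xj xq.
  have := xq m.+1 (ltnSn m); rewrite /x o0 /direction odo_const => /esym E.
  by case: (Hq m.+1); rewrite E => /eqP; [rewrite -val_eqE (negPf j0)|apply/negP].
apply: (@never0 b t); apply: functional_extensionality => n; rewrite -/q.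
case: (leqP n m) => [/qm //|mn]; rewrite -xq // /x o0.
by rewrite /= (@odo_out _ _ _ _ 0) //; [lia|rewrite eq_sym -val_eqE].
Qed.

End Line.

Lemma line_ends o k (ib : 'I_k -> 'I_p.+1 * bool) : injective ib ->
  (forall t, [/\ 0 < (ib t).1, pair_word ord0 (ib t).1 o &
    forall b n, iter n.+1 (direction b (ib t).1) o <> (fun=> ord0)]) ->
  at_least_inf_comps o [:: o] k.
Proof.
move=> ib_inj Hib; exists (fun t => direction (ib t).2 (ib t).1 o); split=> [t|s t st].
  have [i0 Ho H0] := Hib t; split; first by apply/rt_step/direction_adj.
  split; last exact: side_infinite.
  by case=> // /esym; apply: (@direction_free _ _ 0) => //; rewrite -val_eqE -lt0n.
have [i0 Ho H0] := Hib s; have [j0 Ho' _] := Hib t.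
move=> /(side_conn i0 Ho H0)/(_ (side_self _ _ _)).
case E1 : (ib s) (ib t) {ib_inj} (contra_not (@ib_inj s t) st) i0 Ho H0 j0 Ho' => [i b] [j c] /=.
case: (eqVneq j i) => [->|ji] ne i0 Ho H0 j0 Ho'.
  have -> : c = ~~ b by case: b c ne {E1} => [] [].
  exact: side_opp.
(* For distinct letters [i] and [j], a word over both {0, [i]} and {0, [j]} is 0^oo. *)
apply: side_other => //; apply: functional_extensionality => n.
by case: (Ho n) => // En; case: (Ho' n) => // En'; rewrite -En En' eqxx in ji.
Qed.

End LowerBounds.

(** * Classification of words by number of ends *)

Section Classification.
Variable p : nat.
Implicit Types (a c i j : 'I_p.+1) (u v w x y z q o : word p).

Lemma ends_const v : ev_const v -> k_ended v (2 * p).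
Proof.
move=> /ev_const_sorbit vo; apply: k_ended_sorbit vo _.
split; last by move=> F; exact: ends_le_const.
exists [:: fun=> ord0]; apply: (line_ends (@line_index_inj p)) => t.
have i0 := line_index_gt0 t; have H : pair_word ord0 (line_index t).1 (fun=> ord0) by left.
by split=> // b n; apply: direction_free => //; rewrite -val_eqE -lt0n.
Qed.

Lemma ends_pair i u v : 0 < i -> pair_word ord0 i u -> cof u v -> ~ ev_const v ->
  k_ended v 2.
Proof.
move=> i0 Hu uv nc; apply: (k_ended_sorbit (cof_sorbit uv)).
have {nc}nc : ~ ev_const u by move=> /(ev_const_cof uv).
split; last by move=> F; exact: ends_le2.
exists [:: u]; apply: (@line_ends _ _ _ (fun t : 'I_2 => (i, t == ord0))).
  by move=> s t [E]; apply/val_inj; case: s t E => [[|[]]//] ? [[|[]]//].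
(* A line through 0^oo would put [u] in the orbit of the eventually constant words. *)
move=> t; split=> // b n E; apply: nc; apply/ev_const_sorbit; rewrite -E.
elim: n.+1 => [|m IH]; first exact: sorbit_refl.
by apply: sorbit_trans IH; apply: sorbit_sym; apply/rt_step/direction_adj.
Qed.

Definition in_line v := exists i, 0 < i /\ exists u, pair_word ord0 i u /\ cof u v.

Lemma ev_const_in_line v : 0 < p -> ev_const v -> in_line v.
Proof.
move=> p0 [c cv]; case: (eqVneq c ord0) => c0.
  by exists ord_max; split=> //; exists (fun=> c); split=> // n; left.
by exists c; split; [rewrite lt0n|exists (fun=> c); split=> // n; right].
Qed.

Lemma ends_generic v : 0 < p -> ~ in_line v -> k_ended v 1.
Proof.
move=> p0 nl; split; first by exists [::]; exact: ends_ge1.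
move=> F; apply: ends_le1 => [/(ev_const_in_line p0)//|i u i0 Hu uv].
by apply: nl; exists i; split=> //; exists u.
Qed.

(** Position [k] is reserved for [f n] with [n] the 2-adic valuation of [k], so [w] differs from
    each [f n] at infinitely many positions. *)
Lemma diagonal_pair a c (f : nat -> word p) : a != c ->
  exists w, pair_word a c w /\ forall n, ~ cof (f n) w.
Proof.
move=> ac; exists (fun k => if f (logn 2 k) k == a then c else a); split.
  by move=> n; case: ifP; [right|left].
move=> n [N /(_ (2 ^ n * N.*2.+1))].
have -> : logn 2 (2 ^ n * N.*2.+1) = n.
  rewrite lognM ?expn_gt0 // pfactorK // logn_coprime ?addn0 //.
  by rewrite coprime2n /= odd_double.
have leN : N <= 2 ^ n * N.*2.+1.
  by apply: leq_trans (leq_pmull _ _); rewrite ?expn_gt0 //; lia.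
move=> /(_ leN); case: eqP => [-> /eqP|fa /esym //]; by rewrite eq_sym (negPf ac).
Qed.

Lemma uncountable_pair a c (E : word p -> Prop) : a != c ->
  (forall w, pair_word a c w -> ~ ev_const w -> E w) -> uncountably_many_orbits E.
Proof.
move=> ac HE [f Hf].
(* Putting the two constant words in front of [f] keeps the diagonal word from being eventually
   constant. *)
pose g n := if n is n'.+2 then f n' else if n is 0 then fun=> a else fun=> c.
have [w [Hw nw]] := diagonal_pair g ac.
have nc : ~ ev_const w.
  case=> d [N HN]; have := HN N (leqnn N).
  by case: (Hw N) => -> E'; [apply: (nw 0)|apply: (nw 1)]; exists N => n /HN ->.
have [n /sorbit_sym/(sorbit_cof nc)/cof_sym] := Hf w (HE w Hw nc).
exact: (nw n.+2).
Qed.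

End Classification.

(** * The null set of words cofinal with a line *)

Section NullSet.
Local Open Scope ring_scope.

(** The lists are concatenated. As none is empty, the first [k.+1] of them already have an entry of
    index [k], so the default [x0] is never read; the weights are bounded by a geometric series. *)
Lemma enumerate_blocks (T : eqType) (x0 : T) (L : nat -> seq T) (f : T -> rat) eps :
  0 <= eps -> (forall s, 0 <= f s) -> (forall b, (0 < size (L b))%N) ->
  (forall b, \sum_(s <- L b) f s <= eps / 2 ^+ b.+1) ->
  exists u : nat -> T, (forall b s, s \in L b -> exists k, u k = s) /\
    forall n, \sum_(k < n) f (u k) <= eps.
Proof.
move=> eps0 f0 L0 fL; pose C n := flatten [seq L b | b <- iota 0 n].
have CS n : C n.+1 = C n ++ L n by rewrite /C -addn1 iotaD map_cat flatten_cat /= cats0.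
have sizeC n : (n <= size (C n))%N.
  by elim: n => // n IH; rewrite CS size_cat; have := L0 n; lia.
have nthC m n k : (m <= n)%N -> (k < size (C m))%N -> nth x0 (C n) k = nth x0 (C m) k.
  move=> /subnKC <- km; elim: (n - m)%N => [|d IH]; first by rewrite addn0.
  rewrite addnS CS nth_cat IH ifT //; apply: leq_trans km _.
  elim: {IH} d => [|d IH]; first by rewrite addn0.
  by rewrite addnS CS size_cat; apply: leq_trans IH (leq_addr _ _).
exists (fun k => nth x0 (C k.+1) k); split=> [b s sL|n].
  have sC : s \in C b.+1 by rewrite CS mem_cat sL orbT.
  exists (index s (C b.+1)); set k := index _ _.
  rewrite -[RHS](nth_index x0 sC) -/k.
  rewrite -(nthC _ (maxn b.+1 k.+1)) ?leq_maxr //.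
  by apply: nthC; rewrite ?leq_maxl // index_mem.
have le_all : \sum_(k < n) f (nth x0 (C k.+1) k) <= \sum_(s <- C n) f s.
  rewrite (big_nth x0) (big_cat_nat (n := n)) //= -[leLHS]addr0 lerD ?sumr_ge0 //.
  rewrite big_mkord le_eqVlt; apply/orP; left; apply/eqP; apply: eq_bigr => k _.
  by rewrite -(nthC k.+1 n).
apply: le_trans le_all _; suff : \sum_(s <- C n) f s <= eps - eps / 2 ^+ n.
  by move=> /le_trans; apply; rewrite gerBl divr_ge0 // exprn_ge0.
elim: n => [|n IH]; first by rewrite /C big_nil expr0 divr1 subrr.
rewrite CS big_cat /=; apply: le_trans (lerD IH (fL n)) _.
have y0 : 2 ^+ n != 0 :> rat by rewrite expf_neq0.
by rewrite le_eqVlt; apply/orP; left; apply/eqP; rewrite exprS; field.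
Qed.

Lemma two_thirds_small (eps : rat) p : (2 <= p)%N -> 0 < eps ->
  exists M, (2 / p.+1%:R) ^+ M <= eps.
Proof.
move=> p2 eps0; pose M := Num.bound (2 / eps); exists M.
have leM : 2 / eps < M%:R by apply: archi_boundP; rewrite divr_ge0 // ltW.
(* Bernoulli's inequality for (3/2)^M without denominators; it bounds (2/(p+1))^M by 2/(M+2). *)
have bern : (2 ^ M * (M + 2) <= 2 * p.+1 ^ M)%N.
  elim: M {leM} => [|M IH]; first by rewrite !expn0.
  rewrite !expnS; have : (3 * (2 ^ M * (M + 2)) <= p.+1 * (2 * p.+1 ^ M))%N by exact: leq_mul.
  nia.
rewrite expr_div_n ler_pdivrMr ?exprn_gt0 ?ltr0n //.
rewrite -(ler_pM2r (_ : 0 < (M + 2)%:R :> rat)) ?ltr0n ?addn2 //.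
apply: (@le_trans _ _ (2 * p.+1%:R ^+ M)).
  by rewrite -!natrX -!natrM ler_nat; move: bern; rewrite addn2.
rewrite mulrAC ler_pM2r ?exprn_gt0 ?ltr0n // mulrC -ler_pdivrMr //.
by apply: le_trans (ltW leM) _; rewrite ler_nat; lia.
Qed.

Lemma null_in_line p : (2 <= p)%N -> nu_null (@in_line p).
Proof.
move=> p2 eps eps0.
pose good b M := p.+1%:R * (2 / p.+1%:R) ^+ M <= eps / 2 ^+ b.+1 :> rat.
have ex_good b : exists M, good b M.
  have [|M HM] := @two_thirds_small (eps / 2 ^+ b.+1 / p.+1%:R) p p2.
    by rewrite !divr_gt0 ?exprn_gt0 ?ltr0n.
  by exists M; rewrite /good mulrC -ler_pdivlMr ?ltr0n.
pose M b := xchoose (ex_good b).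
(* A word over {0, [i]} from position [b] on is covered through [b] free letters, the letter [i] and
   [M b] bits. The number of codes times the measure of one cylinder is the left side of [good]. *)
pose cyl b (t : b.-tuple 'I_p.+1 * 'I_p.+1 * (M b).-tuple bool) : seq 'I_p.+1 :=
  t.1.1 ++ [seq if e then t.1.2 else ord0 | e <- t.2].
pose L b := [seq cyl b t | t <- enum {: b.-tuple 'I_p.+1 * 'I_p.+1 * (M b).-tuple bool}].
have size_cyl b t : size (cyl b t) = (b + M b)%N by rewrite size_cat size_map !size_tuple.
have sizeL b : size (L b) = (p.+1 ^ b * p.+1 * 2 ^ M b)%N.
  by rewrite size_map -cardE !card_prod !card_tuple card_bool card_ord.
have [|||b|u [uL u_sum]] := @enumerate_blocks _ [::] L (fun s => p.+1%:R ^- size s) eps.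
- exact: ltW.
- by move=> s; rewrite invr_ge0 exprn_ge0.
- by move=> b; rewrite sizeL !muln_gt0 !expn_gt0.
- apply: le_trans (xchooseP (ex_good b)); rewrite -/(M b) big_map.
  rewrite (eq_bigr (fun=> p.+1%:R ^- (b + M b))) => [|t _]; last by rewrite size_cyl.
  rewrite big_const_seq count_predT -(size_map (cyl b)) -/(L b) sizeL iter_addr_0.
  have p0 : p.+1%:R != 0 :> rat by rewrite pnatr_eq0.
  rewrite -[leLHS]mulr_natr !natrM !natrX exprD expr_div_n invfM -!mulrA.
  by rewrite mulrCA mulKf ?expf_neq0 // mulrCA [_^-1 * _]mulrC.
exists u; split=> // w [i [_ [x [Hx [b xw]]]]].
pose t : b.-tuple 'I_p.+1 * 'I_p.+1 * (M b).-tuple bool :=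
  ([tuple w j | j < b], i, [tuple w (b + j)%N == i | j < M b]).
have [k uk] : exists k, u k = cyl b t by apply: (uL b); apply: map_f; rewrite mem_enum.
exists k; rewrite uk => j.
have lt_j : (j < b + M b)%N by rewrite -(size_cyl b t).
rewrite nth_cat size_tuple; case: ltnP => jb.
  by rewrite -[nat_of_ord j]/(nat_of_ord (Ordinal jb)) -tnth_nth tnth_mktuple.
have jM : (j - b < M b)%N by lia.
rewrite (nth_map false) ?size_tuple //.
rewrite -[(j - b)%N]/(nat_of_ord (Ordinal jM)) -tnth_nth tnth_mktuple /= subnKC //.
by case: eqP => // wi; have := Hx j; rewrite -xw // => -[].
Qed.

End NullSet.

Theorem theorem4p16 (p : nat) (hp : (2 <= p)%N) :
  (forall v : word p, k_ended v (2 * p) \/ k_ended v 2 \/ k_ended v 1) /\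
  (* (1) *)
  (forall w : word p,
     k_ended w (2 * p) <-> exists i : 'I_p.+1, cof (fun _ => i) w) /\
  (forall w w' : word p, k_ended w (2 * p) -> k_ended w' (2 * p) -> sorbit w w') /\
  (* (2) *)
  (forall w : word p,
     k_ended w 2 <->
     ((exists i : 'I_p.+1, (0 < i)%N /\
        exists u : word p, (forall n, u n = ord0 \/ u n = i) /\ cof u w) /\
      ~ k_ended w (2 * p))) /\
  uncountably_many_orbits (fun w : word p => k_ended w 2) /\
  (* (3) *)
  (forall w : word p, k_ended w 1 <-> (~ k_ended w (2 * p) /\ ~ k_ended w 2)) /\
  uncountably_many_orbits (fun w : word p => k_ended w 1) /\
  (* nu(E_1) = 1 *)
  nu_null (fun w : word p => ~ k_ended w 1).
Proof.
have p0 : 0 < p by exact: ltnW.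
have ends (w : word p) : [\/ ev_const w /\ k_ended w (2 * p),
    [/\ ~ ev_const w, in_line w & k_ended w 2] |
    [/\ ~ ev_const w, ~ in_line w & k_ended w 1]].
  case: (classic (ev_const w)) => [cw|ncw].
    by apply: Or31; split=> //; exact: ends_const.
  case: (classic (in_line w)) => [lw|nlw].
    by apply: Or32; split=> //; have [i [i0 [u [Hu uw]]]] := lw; exact: (ends_pair i0 Hu).
  by apply: Or33; split=> //; exact: ends_generic.
have neq1 (w : word p) : k_ended w (2 * p) -> ~ k_ended w 2.
  by move=> H /(k_ended_uniq H); lia.
have neq2 (w : word p) : k_ended w (2 * p) -> ~ k_ended w 1.
  by move=> H /(k_ended_uniq H); lia.
have neq3 (w : word p) : k_ended w 2 -> ~ k_ended w 1 by move=> H /(k_ended_uniq H).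
have E2p (w : word p) : k_ended w (2 * p) <-> ev_const w.
  split=> [H|]; last exact: ends_const.
  by case: (ends w) => [[]//|[_ _ /(neq1 _ H)]|[_ _ /(neq2 _ H)]].
split; [|split; [|split; [|split; [|split; [|split; [|split]]]]]].
- by move=> v; case: (ends v) => [[_ ?]|[_ _ ?]|[_ _ ?]]; auto.
- exact: E2p.
- move=> w w' /E2p/ev_const_sorbit wo /E2p/ev_const_sorbit wo'.
  exact: sorbit_trans (sorbit_sym wo) wo'.
- move=> w; split=> [H|[lw /E2p ncw]].
    by case: (ends w) => [[_ /neq1]//|[ncw lw _]|[_ _ /(neq3 _ H)]//]; split=> // /E2p.
  by case: (ends w) => [[/ncw]|[]|[_ /(_ lw)]].
- apply: (@uncountable_pair _ ord0 ord_max) => [|w Hw ncw].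
    by rewrite -val_eqE /= eq_sym -lt0n.
  by apply: (@ends_pair _ ord_max w) => //; exists 0.
- move=> w; split=> [H|[/E2p ncw n2]].
    by split=> [/neq2|/neq3].
  by case: (ends w) => [[/ncw]|[_ _ /n2]|[]].
(* Words over {1, 2} avoid 0, so one cofinal with a {0, [i]}-word would be eventually constant. *)
- apply: (@uncountable_pair _ (inord 1) (inord 2)) => [|w Hw ncw].
    by rewrite -val_eqE /= !inordK // ltnW.
  apply: ends_generic => // -[i [i0 [u [Hu [N HN]]]]]; apply: ncw; exists i, N => n Nn.
  rewrite HN //; case: (Hu n) => // un.
  by case: (Hw n); rewrite HN // un => /(congr1 val); rewrite /= inordK // ltnW.
move=> eps /(null_in_line hp)[u [Hu u_sum]]; exists u; split=> // w nw; apply: Hu.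
by apply: NNPP => nl; apply: nw; exact: ends_generic.
Qed.
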